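(* Let $n\ge 3$, let $G_1,\ldots,G_n$ be (pairwise disjoint) connected graphs with $\lambda_1,\ldots,\lambda_n$ vertices respectively (each $\lambda_i\ge 1$), and let $H$ be a connected graph with vertex set $\{v_1,\ldots,v_n\}$, disjoint from the $G_i$. Let $G$ be a graph obtained by connecting, for each $i$, the vertex $v_i$ of $H$ by an edge to an arbitrarily chosen vertex $u_i$ of $G_i$. If $G$ has a connected partition of type $\mu$, then the complete sun $\overline{S}(n;\lambda_1,\ldots,\lambda_n)$ also has a connected partition of type $\mu$.
   Context: All graphs are finite and simple. $P_k$ denotes the path with $k$ vertices; for $k=1$ the single vertex counts as its leaf. For $n\ge 3$ and positive integers $\lambda_1,\ldots,\lambda_n$, the complete sun $\overline{S}(n;\lambda_1,\ldots,\lambda_n)$ is obtained from the complete graph $K_n$ with vertices $v_1,\ldots,v_n$ and $n$ disjoint paths $P_{\lambda_1},\ldots,P_{\lambda_n}$ (disjoint from $K_n$) by connecting $v_i$ by an edge to a leaf of $P_{\lambda_i}$ for every $i$. A connected partition of a graph $G$ is a partition $\{V_1,\ldots,V_k\}$ of its vertex set such that every induced subgraph $G[V_i]$ is connected; its type is the integer partition whose parts are the sizes $|V_1|,\ldots,|V_k|$ (in weakly decreasing order). *)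

(* Defs.v *)
From mathcomp Require Import all_boot.

Set Implicit Arguments.
Unset Strict Implicit.
Unset Printing Implicit Defensive.

Record sgraph (T : finType) := SGraph {
  adj :> rel T;
  adj_sym : symmetric adj;
  adj_irr : irreflexive adj
}.

(* The empty graph does not count as connected. *)
Definition connected_graph (T : finType) (G : sgraph T) : Prop :=
  0 < #|T| /\ forall x y : T, connect G x y.

Section Induced.
Variables (T : finType) (G : sgraph T) (A : {set T}).

Definition induced_adj : rel {x : T | x \in A} :=
  [rel x y | G (val x) (val y)].

Lemma induced_sym : symmetric induced_adj.
Proof. by move=> x y; apply: adj_sym. Qed.

Lemma induced_irr : irreflexive induced_adj.
Proof. by move=> x; apply: adj_irr. Qed.

Definition induced : sgraph {x : T | x \in A} := SGraph induced_sym induced_irr.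

End Induced.

Definition connected_partition (T : finType) (G : sgraph T)
    (P : {set {set T}}) : Prop :=
  partition P [set: T] /\ forall B, B \in P -> connected_graph (induced G B).

Definition partition_type (T : finType) (P : {set {set T}}) : seq nat :=
  sort geq [seq #|B| | B : {set T} in P].

Definition has_connected_partition (T : finType) (G : sgraph T)
    (mu : seq nat) : Prop :=
  exists2 P : {set {set T}}, connected_partition G P & partition_type P = mu.

Section Complete.
Variable n : nat.

Definition complete_adj : rel 'I_n := [rel i j | i != j].

Lemma complete_sym : symmetric complete_adj.
Proof. by move=> i j; rewrite /complete_adj /= eq_sym. Qed.

Lemma complete_irr : irreflexive complete_adj.
Proof. by move=> i; rewrite /complete_adj /= eqxx. Qed.

Definition complete_graph : sgraph 'I_n := SGraph complete_sym complete_irr.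

End Complete.

Section Path.
Variable k : nat.

Definition path_adj : rel 'I_k := [rel i j : 'I_k | (i.+1 == j) || (j.+1 == i)].

Lemma path_sym : symmetric path_adj.
Proof. by move=> i j; rewrite /path_adj /= orbC. Qed.

Lemma path_irr : irreflexive path_adj.
Proof. by move=> i; rewrite /path_adj /= orbb gtn_eqF. Qed.

Definition path_graph : sgraph 'I_k := SGraph path_sym path_irr.

End Path.

(* The disjoint union of H (left summand) and of all the G i (right summand,   *)
(* tagged by i), together with the edges between i and u i.                    *)
Section Attach.
Variables (n : nat) (H : sgraph 'I_n).
Variables (V : 'I_n -> finType) (G : forall i, sgraph (V i)).
Variable u : forall i, V i.

Definition attach_adj : rel ('I_n + {i : 'I_n & V i}) := fun x y =>
  match x, y with
  | inl i, inl j => H i j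
  | inl i, inr b => b == Tagged V (u i)
  | inr a, inl j => a == Tagged V (u j)
  | inr a, inr b => (tag a == tag b) && G (tag a) (tagged a) (tagged_as a b)
  end.

Lemma attach_sym : symmetric attach_adj.
Proof.
move=> [i|[i x]] [j|[j y]] //=; first exact: adj_sym.
have [eq_ij | ] := eqVneq i j; last by [].
by case: j / eq_ij y => y; rewrite !tagged_asE adj_sym.
Qed.

Lemma attach_irr : irreflexive attach_adj.
Proof. by move=> [i|[i x]] /=; rewrite ?eqxx ?tagged_asE adj_irr. Qed.

Definition attach : sgraph ('I_n + {i : 'I_n & V i})%type :=
  SGraph attach_sym attach_irr.

End Attach.

(* The vertex 0 of path_graph k is a leaf (its only vertex if k = 1).          *)
Definition complete_sun (n : nat) (lam : 'I_n -> nat)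
    (lam_gt0 : forall i, 0 < lam i) :
    sgraph ('I_n + {i : 'I_n & 'I_(lam i)})%type :=
  attach (complete_graph n) (fun i => path_graph (lam i))
    (fun i => Ordinal (lam_gt0 i)).

(* Main.v *)
Require Import Defs.
From mathcomp Require Import all_boot.

(** Why the theorem holds.  The proof transports the given partition along one
    bijection from the vertices of the attached graph to those of the sun.  The
    bijection fixes the core vertices v_i and maps each branch G_i onto the i-th
    path, listing the vertices of G_i block by block and starting with the block
    that contains v_i; block sizes, hence the type, are then preserved for free.

    Since v_i is the only gate of G_i, a connected block that meets G_i either
    contains v_i or lies inside G_i ([block_in_branch]).  So a block inside G_i
    becomes an interval of the i-th path, while a block with a nonempty set of
    core vertices becomes a part of a clique together with, for some of its core
    vertices v_i, an initial segment of the path hanging at v_i.  Both are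
    connected in the sun ([image_block_connected]).

    Listing the vertices block by block is sorting by a key that separates the
    blocks and vanishes on the block of v_i ([sorted_numbering],
    [block_key]). *)

Set Implicit Arguments.
Unset Strict Implicit.
Unset Printing Implicit Defensive.

(** * Connectivity of induced subgraphs *)

Section Within.
Variables (T : finType) (G : sgraph T) (A : {set T}).

(** Adjacency in the subgraph induced on [A], kept on the ambient type so that
    walks can be built without membership proofs inside the vertices. *)
Definition within : rel T := [rel x y | [&& x \in A, y \in A & G x y]].

Lemma within_connect_sym : connect_sym within.
Proof.
apply: sym_connect_sym => x y; rewrite /within /=.
by rewrite adj_sym andbCA.
Qed.

Lemma connect_within_induced (x y : T) (Ax : x \in A) (Ay : y \in A) :
  connect within x y -> connect (induced G A) (Sub x Ax) (Sub y Ay).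
Proof.
case/connectP=> p; elim: p => [|z p IHp] /= in x Ax *.
  move=> _ eq_yx; apply: eq_connect0; apply: val_inj; exact: esym.
case/andP=> /and3P[_ Az Gxz] z_p last_y.
by apply: connect_trans (IHp z Az z_p last_y); apply: connect1.
Qed.

Lemma connected_induced_hub (c : T) :
    c \in A -> {in A, forall x, connect within c x} ->
  connected_graph (induced G A).
Proof.
move=> Ac hub; split; first by apply/card_gt0P; exists (Sub c Ac).
move=> [x Ax] [y Ay]; apply: connect_within_induced.
by apply: connect_trans (hub y Ay); rewrite within_connect_sym hub.
Qed.

End Within.

(** * Transport of a partition along an injection *)

Lemma partition_type_imset (T T' : finType) (f : T -> T') (P : {set {set T}}) :
    injective f ->
  partition_type [set f @: B | B : {set T} in P] = partition_type P.
Proof.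
move=> f_inj; apply/perm_sortP.
- by move=> a b; apply: leq_total.
- by move=> b a c ba cb; apply: leq_trans cb ba.
- by move=> a b /anti_leq.
have /(perm_map (fun B : {set T'} => #|B|)) :
    perm_eq (enum [set f @: B | B : {set T} in P])
            [seq f @: (B : {set T}) | B <- enum P].
  apply: uniq_perm; rewrite ?enum_uniq //.
    by rewrite map_inj_uniq ?enum_uniq //; apply: imset_inj.
  move=> B; rewrite mem_enum; apply/imsetP/mapP => -[C PC ->]; exists C => //.
    by rewrite mem_enum.
  by rewrite -mem_enum.
rewrite -map_comp => /perm_trans; apply.
rewrite (@eq_map _ _ _ (fun B : {set T} => #|B|)) // => B /=.
by rewrite card_imset.
Qed.

Lemma transport_connected_partition (T T' : finType) (G' : sgraph T')
    (f : T -> T') (P : {set {set T}}) (mu : seq nat) :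
    injective f -> (forall y, y \in codom f) -> partition P [set: T] ->
    (forall B, B \in P -> connected_graph (induced G' (f @: B))) ->
  partition_type P = mu -> has_connected_partition G' mu.
Proof.
move=> f_inj f_onto partP conn typeP.
exists [set f @: B | B : {set T} in P]; last by rewrite partition_type_imset.
split; last by move=> _ /imsetP[B PB ->]; apply: conn.
suff -> : [set: T'] = f @: [set: T] by rewrite imset_partition.
apply/esym/setP => y; rewrite inE; apply/imsetP.
by have /codomP[x ->] := f_onto y; exists x.
Qed.

(** * Numbering the vertices of a branch *)

(** The numbers are the positions in a list sorted by [key].  The
    converse implication fails when [key] is not injective: vertices sharing a
    key still get distinct numbers, in an arbitrary order. *)
Lemma sorted_numbering (T : finType) (key : T -> nat) (m : nat) :
    #|T| = m ->
  {g : T -> 'I_m | injective g & forall x y, g x <= g y -> key x <= key y}.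
Proof.
move=> cardT; pose s := sort (relpre key leq) (enum T).
have s_all x : x \in s by rewrite mem_sort mem_enum.
have lt_index x : index x s < m.
  by rewrite -cardT cardE -(size_sort (relpre key leq)) index_mem.
exists (fun x => Ordinal (lt_index x)) => [x y [eq_i] | x y /=].
  by rewrite -(nth_index x (s_all x)) eq_i nth_index.
apply: (@sorted_leq_index _ (relpre key leq)) => //.
- by move=> b a c; apply: leq_trans.
- by move=> a /=.
- by apply: sort_sorted => a b; apply: leq_total.
Qed.

Section AttachMap.
Variables (n : nat) (V W : 'I_n -> finType) (g : forall i, V i -> W i).

Definition attach_map (z : 'I_n + {i : 'I_n & V i}) :
    'I_n + {i : 'I_n & W i} :=
  match z with
  | inl i => inl i
  | inr p => inr (Tagged W (g (tagged p)))
  end.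

Hypothesis g_inj : forall i, injective (@g i).

Lemma attach_map_inj : injective attach_map.
Proof.
move=> [i | [i x]] [j | [j y]] //=; first by case=> ->.
case=> eq_ij; case: j / eq_ij y => y /eqP.
by rewrite eq_Tagged => /eqP/g_inj ->.
Qed.

Lemma attach_map_onto :
  (forall i, #|W i| <= #|V i|) -> forall z, z \in codom attach_map.
Proof.
move=> cardW [i | [i y]]; apply/codomP; first by exists (inl i).
have /codomP[x ->] := inj_card_onto (@g_inj i) (cardW i) y.
by exists (inr (Tagged V x)).
Qed.

End AttachMap.

(** * Blocks of a connected partition of an attached graph *)

Section AttachBlocks.
Variables (n : nat) (H : sgraph 'I_n) (V : 'I_n -> finType).
Variables (G : forall i, sgraph (V i)) (u : forall i, V i).

(** Inside a block avoiding v_i, no edge leaves the branch G_i, because the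
    only edge of the attached graph doing so ends at v_i. *)
Lemma block_in_branch (B : {set 'I_n + {i : 'I_n & V i}}) (i : 'I_n) (x : V i) :
    connected_graph (induced (attach H G u) B) ->
    inr (Tagged V x) \in B -> inl i \notin B ->
  {in B, forall z, exists y : V i, z = inr (Tagged V y)}.
Proof.
case=> _ conn Bx Bi z Bz.
pose branch (w : {w | w \in B}) := if val w is inr p then tag p == i else false.
have closed_branch : closed (induced (attach H G u) B) branch.
  move=> [[j | [j a]] Ba] [[k | [k b]] Bb] //=; rewrite /in_mem /branch /=.
  - move/eqP=> eq_b; apply/esym/eqP => eq_ki; case/negP: Bi.
    by rewrite -eq_ki (congr1 tag eq_b : k = j).
  - move/eqP=> eq_a; apply/eqP => eq_ji; case/negP: Bi.
    by rewrite -eq_ji (congr1 tag eq_a : j = k).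
  - by case/andP=> /eqP /= eq_jk _; rewrite eq_jk.
have := closed_connect closed_branch 
  (conn (exist (fun w => w \in B) _ Bx) (exist (fun w => w \in B) _ Bz)).
rewrite /in_mem /branch /= eqxx; case: z {Bz} => [// | [j y]] /=.
by move/esym/eqP => eq_ji; rewrite -eq_ji; exists y.
Qed.

Variable P : {set {set 'I_n + {i : 'I_n & V i}}}.

(** The value 0 is reserved for the block of v_i, so that sorting by this key
    puts the vertices sharing the block of v_i next to v_i. *)
Definition block_key (i : 'I_n) (x : V i) : nat :=
  let B := pblock P (inr (Tagged V x)) in
  if inl i \in B then 0 else (enum_rank B).+1.

Hypothesis partP : partition P setT.

Lemma pblock_eq (B : {set 'I_n + {i : 'I_n & V i}}) z :
  B \in P -> (z \in B) = (pblock P z == B).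
Proof.
have trivP := partition_trivIset partP => PB.
apply/idP/eqP => [|<-]; first exact: def_pblock.
by rewrite mem_pblock (cover_partition partP).
Qed.

Lemma block_key_core (B : {set 'I_n + {i : 'I_n & V i}}) (i : 'I_n) (x : V i) :
  B \in P -> inl i \in B -> inr (Tagged V x) \in B -> block_key x = 0.
Proof. by move=> PB Bi; rewrite pblock_eq // /block_key => /eqP->; rewrite Bi. Qed.

Lemma block_key_inj (i : 'I_n) (x y : V i) :
    block_key x = block_key y ->
  pblock P (inr (Tagged V x)) = pblock P (inr (Tagged V y)).
Proof.
have P_pblock z : pblock P z \in P by rewrite pblock_mem ?(cover_partition partP).
rewrite /block_key; case: ifPn => Bx; case: ifPn => By //.
  by move: Bx By; rewrite !pblock_eq // => /eqP <- /eqP.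
by case=> /val_inj/enum_rank_inj.
Qed.

End AttachBlocks.

(** * Connected subsets of the complete sun *)

Section Sun.
Variables (n : nat) (lam : 'I_n -> nat) (lam_gt0 : forall i, 0 < lam i).

Notation sun := (complete_sun lam_gt0).
Notation on_path c := (inr (Tagged (fun i => 'I_(lam i)) c)).

Lemma sun_path_segment (A : {set 'I_n + {i : 'I_n & 'I_(lam i)}}) (i : 'I_n)
    (a b : 'I_(lam i)) :
    a <= b -> (forall c : 'I_(lam i), a <= c <= b -> on_path c \in A) ->
  connect (within sun A) (on_path a) (on_path b).
Proof.
case: b => b lt_b; elim: b => [|b IHb] /= in lt_b *.
  rewrite leqn0 => /eqP a0 _.
  by rewrite (_ : a = Ordinal lt_b) ?connect0 //; apply: val_inj.
rewrite leq_eqVlt => /predU1P[eq_ab | lt_ab] seg.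
  by rewrite (_ : a = Ordinal lt_b) ?connect0 //; apply/val_inj.
apply: (@connect_trans _ _ (on_path (Ordinal (ltnW lt_b)))).
  apply: IHb => // c /andP[le_ac le_cb]; apply: seg.
  by rewrite le_ac (leq_trans le_cb).
apply: connect1; rewrite /within /= !seg /= ?leqnn ?leqnSn ?andbT //.
- by rewrite eqxx tagged_asE /path_adj /= eqxx.
- exact: ltnW.
Qed.

(** * The image of a block is connected *)

Variables (H : sgraph 'I_n) (V : 'I_n -> finType).
Variables (G : forall i, sgraph (V i)) (u : forall i, V i).
Variable P : {set {set 'I_n + {i : 'I_n & V i}}}.
Variable g : forall i, V i -> 'I_(lam i).
Hypothesis partP : partition P setT.
Hypothesis g_onto : forall i c, c \in codom (@g i).
Hypothesis g_sorted :
  forall i (x y : V i), g x <= g y -> block_key P x <= block_key P y.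

(** By sortedness every vertex numbered between two vertices of equal key has
    that same key, and keys determine blocks. *)
Lemma image_interval (B : {set 'I_n + {i : 'I_n & V i}}) (i : 'I_n) (x y : V i)
    (c : 'I_(lam i)) :
    B \in P -> inr (Tagged V x) \in B -> inr (Tagged V y) \in B ->
  g x <= c <= g y -> on_path c \in attach_map g @: B.
Proof.
move=> PB Bx By /andP[]; have /codomP[z ->] := g_onto c => le_xz le_zy.
apply/imsetP; exists (inr (Tagged V z)) => //.
have key_xy : block_key P x = block_key P y.
  by move: Bx By; rewrite !(pblock_eq partP) // /block_key => /eqP-> /eqP->.
have key_xz : block_key P x = block_key P z.
  by apply/anti_leq; rewrite g_sorted //= key_xy g_sorted.
by rewrite (pblock_eq partP) // -(block_key_inj partP key_xz) -(pblock_eq partP).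
Qed.

(** Key 0 is the least one, so the block of v_i occupies an initial segment. *)
Lemma image_initial (B : {set 'I_n + {i : 'I_n & V i}}) (i : 'I_n) (x : V i)
    (c : 'I_(lam i)) :
    B \in P -> inl i \in B -> inr (Tagged V x) \in B ->
  c <= g x -> on_path c \in attach_map g @: B.
Proof.
move=> PB Bi Bx; have /codomP[z ->] := g_onto c => le_zx.
apply/imsetP; exists (inr (Tagged V z)) => //.
have key_x := block_key_core partP PB Bi Bx.
have key_zx : block_key P z = block_key P x.
  by apply/eqP; rewrite eqn_leq g_sorted // key_x.
by rewrite (pblock_eq partP) // (block_key_inj partP key_zx) -(pblock_eq partP).
Qed.

Lemma image_block_connected (B : {set 'I_n + {i : 'I_n & V i}}) :
    B \in P -> connected_graph (induced (attach H G u) B) ->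
  connected_graph (induced sun (attach_map g @: B)).
Proof.
move=> PB connB; set A := attach_map g @: B.
have A_map z : z \in B -> attach_map g z \in A by apply: imset_f.
have [j Bj | noB] := pickP [pred j | inl j \in B].
  (* The hub is any core vertex of the block: it is adjacent to all the others. *)
  have core i : inl i \in B -> connect (within sun A) (inl j) (inl i).
    have [-> // | neq_ij Bi] := eqVneq i j.
    apply: connect1; rewrite /within /= (A_map _ Bj) (A_map _ Bi) /=.
    by rewrite /complete_adj /= eq_sym.
  apply: (@connected_induced_hub _ _ _ (inl j)); first exact: A_map Bj.
  move=> _ /imsetP[[i | [i x]] Bz ->] /=; first exact: core.
  have Bi : inl i \in B.
    by apply/negP => /negP /(block_in_branch connB Bz) /(_ _ Bj)[].
  have initial := image_initial PB Bi Bz.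
  apply: connect_trans (core i Bi) _.
  apply: (@connect_trans _ _ (on_path (Ordinal (lam_gt0 i)))).
    apply: connect1; rewrite /within /= (A_map _ Bi) initial //=.
  by apply: sun_path_segment => // c /initial.
have /card_gt0P[[[k | [i x]] Bx] _] := connB.1.
  by have := noB k; rewrite /= Bx.
have in_branch := block_in_branch connB Bx (negbT (noB i)).
apply: (@connected_induced_hub _ _ _ (attach_map g (inr (Tagged V x)))).
  exact: A_map.
move=> _ /imsetP[z Bz ->]; have [y eq_z] := in_branch z Bz.
rewrite {z}eq_z /= in Bz *.
have [le_xy | /ltnW le_yx] := leqP (g x) (g y); last rewrite within_connect_sym.
  by apply: sun_path_segment => // c; apply: image_interval.
by apply: sun_path_segment => // c; apply: image_interval.
Qed.

End Sun.

Theorem lemma3p10 (n : nat) (n_ge3 : 3 <= n)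
    (lam : 'I_n -> nat) (lam_gt0 : forall i : 'I_n, 0 < lam i)
    (V : 'I_n -> finType) (card_V : forall i : 'I_n, #|V i| = lam i)
    (G : forall i : 'I_n, sgraph (V i))
    (G_conn : forall i : 'I_n, connected_graph (G i))
    (H : sgraph 'I_n) (H_conn : connected_graph H)
    (u : forall i : 'I_n, V i) (mu : seq nat) :
  has_connected_partition (attach H G u) mu ->
  has_connected_partition (complete_sun lam_gt0) mu.
Proof.
case=> P [partP connP] typeP.
pose num i := sorted_numbering (@block_key _ _ P i) (card_V i).
pose g i : V i -> 'I_(lam i) := s2val (num i).
have g_inj i : injective (g i) := s2valP (num i).
have g_sorted i := s2valP' (num i) : forall x y, g i x <= g i y -> _.
have leq_card i : #|'I_(lam i)| <= #|V i| by rewrite card_ord card_V.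
apply: (@transport_connected_partition _ _ _ (attach_map g) P) => //.
- exact: attach_map_inj.
- exact: attach_map_onto.
move=> B PB; apply: image_block_connected partP _ g_sorted _ PB (connP B PB).
by move=> i c; apply: inj_card_onto (g_inj i) (leq_card i) c.
Qed.
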